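(* Let $\ell\ge2$ and let $\rho$ be a regular representation of ${\rm GL}_n(\mathfrak o_\ell)$. Then the restriction of $\rho$ to ${\rm SL}_n(\mathfrak o_\ell)$ is multiplicity free.
   Context: $\mathfrak o$ is the ring of integers of a non-archimedean local field with uniformizer $\varpi$ and residue field $\mathbb F_q$; $\mathfrak o_r=\mathfrak o/\varpi^r\mathfrak o$. Let $K_\ell^{\ell-1}=\ker({\rm GL}_n(\mathfrak o_\ell)\to{\rm GL}_n(\mathfrak o_{\ell-1}))=\{I+\varpi^{\ell-1}y\}$. Fix a character $\varphi$ of $(\mathfrak o_\ell,+)$ nontrivial on $\varpi^{\ell-1}\mathfrak o_\ell$; each $x\in M_n(\mathbb F_q)$ gives a character $\varphi_x(I+\varpi^{\ell-1}y)=\varphi(\varpi^{\ell-1}\mathrm{tr}(\hat xy))$ of $K_\ell^{\ell-1}$ ($\hat x$ any lift of $x$). $x\in M_n(\mathbb F_q)$ is regular if its characteristic polynomial equals its minimal polynomial. An irreducible representation of ${\rm GL}_n(\mathfrak o_\ell)$ is regular if its restriction to $K_\ell^{\ell-1}$ contains $\varphi_x$ for some regular $x$. *)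

(* Defs.v *)
From HB Require Import structures.
From mathcomp Require Import all_boot all_order all_algebra all_fingroup all_solvable all_field all_character.
Set Implicit Arguments. Unset Strict Implicit. Unset Printing Implicit Defensive.
Import Order.TTheory GRing.Theory Num.Theory.
Local Open Scope ring_scope.

(* o_ell as a finite commutative local ring R with uniformizer w:
   w^ell = 0, w^(ell-1) <> 0, and every non-unit lies in wR
   (so R is local with principal maximal ideal wR). *)
Definition trunc_dvr (R : finComUnitRingType) (w : R) (ell : nat) : Prop :=
  [/\ w ^+ ell = 0, w ^+ ell.-1 != 0 &
      forall a : R, a \isn't a GRing.unit -> exists b, a = w * b].

Definition residue_map (R : finComUnitRingType) (w : R) (k : finFieldType)
    (pi : {rmorphism R -> k}) : Prop :=
  (forall c : k, exists a : R, pi a = c) /\ forall a : R, pi a = 0 <-> exists b, a = w * b.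

Definition additive_character (R : finComUnitRingType) (phi : R -> algC) : Prop :=
  (forall a b, phi (a + b) = phi a * phi b) /\ (forall a, phi a != 0).

Definition regular_mx (k : fieldType) (m : nat) (x : 'M[k]_m.+1) : bool :=
  char_poly x == mxminpoly x.

Definition SLset (n : nat) (R : finComUnitRingType) : {set {'GL_n[R]}} :=
  [set g : {'GL_n[R]} | \det (GLval g) == 1].

Lemma SL_group_set n R : group_set (SLset n R).
Proof.
apply/group_setP; split; first by rewrite inE GL_1E det1.
move=> x y; rewrite !inE GL_ME => /eqP dx /eqP dy.
by rewrite det_mulmx dx dy mulr1.
Qed.

Canonical SL_group n R := Group (SL_group_set n R).

(* The restriction of rho to K^{ell-1} = {I + w^(ell-1) y} contains the
   character phi_x, where xh is a lift of x:
   phi_x(I + w^(ell-1) y) = phi(w^(ell-1) tr(xh y)). *)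
Definition contains_phi_x (n : nat) (R : finComUnitRingType) (w : R) (ell : nat)
    (phi : R -> algC) (d : nat) (rho : mx_representation algC 'GL_n[R] d)
    (xh : 'M[R]_n.-1.+1) : Prop :=
  exists2 v : 'rV[algC]_d, v != 0 &
    forall (g : {'GL_n[R]}) (y : 'M[R]_n.-1.+1),
      GLval g = 1 + w ^+ ell.-1 *: y ->
      v *m rho g = phi (w ^+ ell.-1 * \tr (xh *m y)) *: v.

Definition regular_rep (n : nat) (R : finComUnitRingType) (w : R) (ell : nat)
    (k : finFieldType) (pi : {rmorphism R -> k})
    (phi : R -> algC) (d : nat) (rho : mx_representation algC 'GL_n[R] d) : Prop :=
  exists2 xh : 'M[R]_n.-1.+1, regular_mx (map_mx pi xh) &
    contains_phi_x w ell phi rho xh.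

(* Main.v *)
(* Let U be the lower unitriangular subgroup of GL_n(o_l) and theta the character
   u |-> phi (tr (J u)) of U, with J the superdiagonal shift.

   Any irreducible representation of GL_n(o_l) contains theta at most once: by Gelfand's trick
   with the flip tau across the antidiagonal it suffices that, for each g, either some relation
   h g = g h' in U has theta h <> theta h', or tau g lies in U g U with the right value of theta.
   Since U - 1 is a module and theta is linear on it, in the absence of such a relation Fourier
   duality over M_n(o_l) gives y1, y2 in J + (lower triangular matrices) with y1 g = g y2.  Both
   are U-conjugate to the same companion matrix C, so that g is, up to U on both sides, a
   polynomial in C, and tau C is again U-conjugate to C.

   A regular representation does contain theta: it contains the character of K^(l-1) attached
   to a companion matrix C, and averaging over congruence subgroups extends theta from
   U cap K^(i+1) to U cap K^i, because no nonzero strictly triangular matrix commutes with C.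

   Since U lies in SL_n(o_l), theta occurs exactly once in the restriction to SL_n(o_l), all of
   whose irreducible constituents have the same multiplicity by Clifford's theorem. *)
Require Import Defs.
From HB Require Import structures.
From mathcomp Require Import all_boot all_order all_algebra all_fingroup all_solvable all_field all_character.
From mathcomp Require Import zify ring.
Import Order.TTheory GRing.Theory Num.Theory.
Local Open Scope ring_scope.

Set Implicit Arguments. Unset Strict Implicit. Unset Printing Implicit Defensive.

(** * Shift-like and companion matrices *)

Section Flip.
Variables (R : comNzRingType) (N : nat).
Implicit Types A B X : 'M[R]_N.+1.

(** Antitransposition: unlike the transpose, this anti-automorphism preserves lower triangular
    matrices and fixes the shift. *)
Definition flip X : 'M[R]_N.+1 := \matrix_(i, j) X (rev_ord j) (rev_ord i).

Lemma flipK : involutive flip.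
Proof. by move=> X; apply/matrixP=> i j; rewrite !mxE !rev_ordK. Qed.

Lemma flipD A B : flip (A + B) = flip A + flip B.
Proof. by apply/matrixP=> i j; rewrite !mxE. Qed.

Lemma flipB A B : flip (A - B) = flip A - flip B.
Proof. by apply/matrixP=> i j; rewrite !mxE. Qed.

Lemma flip1 : flip 1 = 1.
Proof. by apply/matrixP=> i j; rewrite !mxE (inj_eq rev_ord_inj) eq_sym. Qed.

Lemma flipM A B : flip (A * B) = flip B * flip A.
Proof.
apply/matrixP=> i j; rewrite !mxE (reindex_inj rev_ord_inj) /=.
by apply: eq_bigr => k _; rewrite !mxE mulrC.
Qed.

Lemma mxtrace_flip A : \tr (flip A) = \tr A.
Proof.
by rewrite /mxtrace [RHS](reindex_inj rev_ord_inj); apply: eq_bigr => i _; rewrite mxE.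
Qed.

Lemma det_flip A : \det (flip A) = \det A.
Proof.
have -> : flip A = row_perm (perm rev_ord_inj) (col_perm (perm rev_ord_inj) A^T).
  by apply/matrixP=> i j; rewrite !mxE !permE.
rewrite row_permE col_permE !det_mulmx !det_perm det_tr odd_permV mulrC -mulrA.
by rewrite -signr_addb addbb mulr1.
Qed.

End Flip.

Lemma char_poly_flip (R : comNzRingType) N (A : 'M[R]_N.+1) :
  char_poly (flip A) = char_poly A.
Proof.
rewrite /char_poly -[RHS]det_flip; congr (\det _); apply/matrixP=> i j.
by rewrite !mxE (inj_eq rev_ord_inj) eq_sym.
Qed.

Section Companion.
Variables (R : comUnitRingType) (N : nat).
Local Notation M := 'M[R]_N.+1.
Implicit Types (A B X Y : M) (v : 'rV[R]_N.+1).

Definition shift_mx : M := \matrix_(i, j) (i.+1 == j :> nat)%:R.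

(** With the coefficients in the last row and row vectors acting, the first basis vector is cyclic,
    and only the last row differs from [shift_mx]. *)
Definition companion (p : {poly R}) : M :=
  \matrix_(i, j) if i == ord_max then - p`_j else (i.+1 == j :> nat)%:R.

Definition krylov v A : M := \matrix_(i < N.+1) (v *m A ^+ i).

Definition strict_trig A := [forall i : 'I_N.+1, forall j : 'I_N.+1, (i <= j)%N ==> (A i j == 0)].

Lemma strict_trigP A :
  reflect (forall i j : 'I_N.+1, (i <= j)%N -> A i j = 0) (strict_trig A).
Proof.
by apply: (iffP 'forall_'forall_implyP) => h i j /h /eqP.
Qed.

Lemma strict_trig_trig A : strict_trig A -> is_trig_mx A.
Proof. by move/strict_trigP=> h; apply/is_trig_mxP => i j /ltnW/h. Qed.

Lemma strict_trig0 : strict_trig 0.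
Proof. by apply/strict_trigP=> i j _; rewrite mxE. Qed.

Lemma strict_trigD A B : strict_trig A -> strict_trig B -> strict_trig (A + B).
Proof.
move=> /strict_trigP hA /strict_trigP hB; apply/strict_trigP=> i j ij.
by rewrite mxE hA ?hB ?addr0.
Qed.

Lemma strict_trigN A : strict_trig A -> strict_trig (- A).
Proof. by move=> /strict_trigP hA; apply/strict_trigP=> i j ij; rewrite mxE hA ?oppr0. Qed.

Lemma strict_trigZ a A : strict_trig A -> strict_trig (a *: A).
Proof. by move=> /strict_trigP hA; apply/strict_trigP=> i j ij; rewrite mxE hA ?mulr0. Qed.

Lemma strict_trigMl A B : is_trig_mx A -> strict_trig B -> strict_trig (A * B).
Proof.
move=> /is_trig_mxP hA /strict_trigP hB; apply/strict_trigP=> i j ij.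
rewrite mxE big1 // => k _; have [ik|ki] := ltnP i k; first by rewrite hA ?mul0r.
by rewrite hB ?mulr0 // (leq_trans ki).
Qed.

Lemma strict_trigM A B : strict_trig A -> strict_trig B -> strict_trig (A * B).
Proof. by move/strict_trig_trig; apply: strict_trigMl. Qed.

Lemma mxtrace_trigM A B : is_trig_mx A -> strict_trig B -> \tr (A *m B) = 0.
Proof.
move=> hA hB; have /strict_trigP h := strict_trigMl hA hB.
by rewrite /mxtrace big1 // => i _; apply: h.
Qed.

Lemma mxtrace_shift_like A B :
  is_trig_mx (A - shift_mx) -> strict_trig B -> \tr (A *m B) = \tr (shift_mx *m B).
Proof.
by move=> hA hB; rewrite -[A](subrK shift_mx) mulmxDl mxtraceD mxtrace_trigM ?add0r.
Qed.

Lemma shift_strictM_trig A : strict_trig A -> is_trig_mx (shift_mx * A).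
Proof.
move=> /strict_trigP hA; apply/is_trig_mxP=> i j ij; rewrite mxE big1 // => k _.
by rewrite mxE; case: eqP => [ik|_]; rewrite ?mul0r // hA ?mulr0 // -ik.
Qed.

(** [shift_mx * A] is still lower triangular, hence trace-orthogonal to [B]. This makes theta
    multiplicative on the unitriangular group. *)
Lemma mxtrace_shiftM A B : strict_trig A -> strict_trig B -> \tr (shift_mx *m (A * B)) = 0.
Proof. by move=> hA hB; rewrite mulmxA mxtrace_trigM // shift_strictM_trig. Qed.

Lemma unitri_det A : strict_trig (A - 1) -> \det A = 1.
Proof.
move=> /strict_trigP h.
have hE (i j : 'I_N.+1) : (i <= j)%N -> A i j = (i == j)%:R.
  by move=> /h; rewrite !mxE => /eqP; rewrite subr_eq0 => /eqP.
rewrite det_trig; last first.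
  by apply/is_trig_mxP => i j ij; rewrite (hE _ _ (ltnW ij)) -val_eqE ltn_eqF.
by rewrite big1 // => i _; rewrite hE // eqxx.
Qed.

Lemma unitri_unit A : strict_trig (A - 1) -> A \in unitmx.
Proof. by move=> As; rewrite unitmxE unitri_det ?unitr1. Qed.

(** * Krylov matrices and the companion form *)

Lemma row_krylov v A (i : 'I_N.+1) : row i (krylov v A) = v *m A ^+ i.
Proof. by rewrite rowK. Qed.

Lemma horner_mx_sum A (p : {poly R}) :
  horner_mx A p = \sum_(i < size p) p`_i *: A ^+ i.
Proof.
rewrite -{1}[p]coefK poly_def rmorph_sum; apply: eq_bigr => i _.
by rewrite /= linearZ /= rmorphXn /= horner_mx_X.
Qed.

(** Multiplication by [A] moves each row to the next, and Cayley-Hamilton rewrites the last one. *)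
Lemma krylov_companion v A : krylov v A *m A = companion (char_poly A) *m krylov v A.
Proof.
apply/row_matrixP=> i; rewrite !row_mul row_krylov -mulmxA.
have -> : A ^+ i *m A = A ^+ i.+1 by rewrite exprSr.
have e_i u : row i (companion (char_poly A)) *m u =
  \sum_j companion (char_poly A) i j *: row j u.
  by rewrite mulmx_sum_row; apply: eq_bigr => j _; rewrite mxE.
rewrite {}e_i; under eq_bigr => j _ do rewrite row_krylov mxE.
have [->|ni] := eqVneq i ord_max.
  have := Cayley_Hamilton A; rewrite horner_mx_sum size_char_poly big_ord_recr /=.
  have := char_poly_monic A; rewrite monicE /lead_coef size_char_poly /= => /eqP ->.
  rewrite scale1r => /eqP; rewrite addrC addr_eq0 => /eqP ->.
  rewrite mulmxN mulmx_sumr -sumrN; apply: eq_bigr => j _.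
  by rewrite -scalemxAr scaleNr.
have lt_i : (i.+1 < N.+1)%N.
  by move: ni (ltn_ord i); rewrite -val_eqE /=; lia.
rewrite (bigD1 (Ordinal lt_i)) //= eqxx scale1r big1 ?addr0 // => j.
by rewrite -val_eqE /= eq_sym => /negPf->; rewrite scale0r.
Qed.

Lemma companion_shift_like p : is_trig_mx (companion p - shift_mx).
Proof.
apply/is_trig_mxP=> i j ij; rewrite !mxE; case: eqP => [i_max|_]; last by rewrite subrr.
by move: ij (ltn_ord j); rewrite i_max /= => /leq_trans h /h; rewrite ltnn.
Qed.

Let e0 : 'rV[R]_N.+1 := delta_mx 0 0.

Lemma delta_companionX p (i : 'I_N.+1) : e0 *m companion p ^+ i = delta_mx 0 i.
Proof.
case: i; elim=> [|i IHi] lt_i.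
  by rewrite expr0 mulmx1; congr delta_mx; apply: val_inj.
rewrite exprSr mulmxA (IHi (ltnW lt_i)) -rowE.
apply/rowP=> j; rewrite !mxE eqxx -!val_eqE /= ltn_eqF 1?eq_sym //.
Qed.

(** The first row determines a matrix commuting with C, because [e0] times [C ^+ i] is the i-th
    basis vector. The factor [s] permits commutation modulo its annihilator only. *)
Lemma commute_companion_eq0 p (s : R) X :
    s *: (companion p *m X) = s *: (X *m companion p) -> s *: row 0 X = 0 ->
  s *: X = 0.
Proof.
move=> sCX s0.
have sC i : s *: (companion p ^+ i *m X) = s *: (X *m companion p ^+ i).
  elim: i => [|i IHi]; first by rewrite expr0 mul1mx mulmx1.
  have {1}-> : companion p ^+ i.+1 = companion p ^+ i *m companion p by rewrite exprSr.
  have -> : companion p ^+ i.+1 = companion p ^+ i *m companion p by rewrite exprSr.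
  rewrite -mulmxA scalemxAr sCX -scalemxAr !mulmxA.
  by rewrite [LHS]scalemxAl IHi -scalemxAl.
apply/row_matrixP=> i; rewrite linearZ /= linear0.
rewrite rowE -(delta_companionX p) -mulmxA scalemxAr.
by rewrite sC -scalemxAr mulmxA -rowE scalemxAl s0 mul0mx.
Qed.

(** The first row of [X] supplies the coefficients of [q]: both sides then commute with C and share
    their first row. *)
Lemma commute_companion p X :
  companion p *m X = X *m companion p -> exists q, X = horner_mx (companion p) q.
Proof.
move=> CX; exists (rVpoly (row 0 X)); apply/eqP; rewrite -subr_eq0; apply/eqP.
rewrite -[LHS]scale1r; apply: (@commute_companion_eq0 p).
  rewrite mulmxBr mulmxBl CX; congr (_ *: (_ - _)).
  have : horner_mx (companion p) ('X * rVpoly (row 0 X)) =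
         horner_mx (companion p) (rVpoly (row 0 X) * 'X) by rewrite mulrC.
  by rewrite !rmorphM /= horner_mx_X.
rewrite scale1r linearB /= [row 0 (horner_mx _ _)]rowE.
have -> : horner_mx (companion p) (rVpoly (row 0 X)) =
    \sum_(i < N.+1) X 0 i *: companion p ^+ i.
  rewrite /rVpoly poly_def rmorph_sum; apply: eq_bigr => i _ /=.
  by rewrite linearZ /= rmorphXn /= horner_mx_X valK mxE.
rewrite mulmx_sumr; under eq_bigr => i _ do rewrite -scalemxAr delta_companionX.
apply/eqP; rewrite subr_eq0; apply/eqP/rowP=> j; rewrite summxE (bigD1 j) //=.
rewrite !mxE !eqxx mulr1 big1 ?addr0 // => i ij; rewrite !mxE eqxx.
by rewrite eq_sym (negPf ij) mulr0.
Qed.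

(** Each factor [A] extends the support of a row vector by at most one place to the right, with
    coefficient 1 there. *)
Lemma krylov_unitri A :
  is_trig_mx (A - shift_mx) -> strict_trig (krylov e0 A - 1).
Proof.
move=> /is_trig_mxP hA.
have AE (i j : 'I_N.+1) : (i < j)%N -> A i j = (i.+1 == j)%:R.
  by move=> /hA; rewrite !mxE => /eqP; rewrite subr_eq0 => /eqP.
suff h (i : nat) (j : 'I_N.+1) : (i <= j)%N -> (e0 *m A ^+ i) 0 j = (i == j)%:R.
  by apply/strict_trigP=> i j ij; rewrite mxE [krylov _ _ _ _]mxE h // !mxE subrr.
elim: i j => [|i IHi] j ij.
  by rewrite expr0 mulmx1 !mxE eqxx eq_sym.
rewrite exprSr mulmxA mxE.
have lt_i : (i < N.+1)%N by apply: ltn_trans ij (ltn_ord j).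
rewrite (bigD1 (Ordinal lt_i)) //= IHi // eqxx mul1r AE // big1 ?addr0 // => k ki.
have [le_ik|lt_ki] := leqP i k.
  by rewrite IHi // -val_eqE /= in ki *; rewrite eq_sym (negPf ki) mul0r.
rewrite AE ?(leq_trans lt_ki (ltnW ij)) // ltn_eqF ?mulr0 //.
exact: leq_trans ij.
Qed.

Lemma char_poly_conj A B g : g \in unitmx -> g * A = B * g -> char_poly A = char_poly B.
Proof.
move=> ug gA; rewrite /char_poly; set g' := map_mx polyC g.
have eq_g : g' *m char_poly_mx A = char_poly_mx B *m g'.
  rewrite /char_poly_mx mulmxBr mulmxBl scalar_mxC -!map_mxM /=.
  by congr (_ - map_mx _ _); exact: gA.
have := congr1 determinant eq_g; rewrite !det_mulmx [RHS]mulrC det_map_mx.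
move/(congr1 ( *%R (\det g)^-1%:P)); rewrite !mulrA -rmorphM /= mulVr ?mul1r //.
Qed.

Lemma flip_shift : flip shift_mx = shift_mx.
Proof.
apply/matrixP=> i j; rewrite !mxE /=; congr (_ %:R); congr (nat_of_bool _).
by apply/eqP/eqP; move: (ltn_ord i) (ltn_ord j); lia.
Qed.

Lemma flip_trig A : is_trig_mx A -> is_trig_mx (flip A).
Proof.
move=> /is_trig_mxP h; apply/is_trig_mxP=> i j ij; rewrite mxE h //=.
by move: (ltn_ord i) (ltn_ord j); lia.
Qed.

Lemma flip_strict_trig A : strict_trig A -> strict_trig (flip A).
Proof.
move=> /strict_trigP h; apply/strict_trigP=> i j ij; rewrite mxE h //=.
by move: (ltn_ord i) (ltn_ord j); lia.
Qed.

Lemma flip_unit A : A \in unitmx -> flip A \in unitmx.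
Proof.
move=> uA; have /mulmx1_unit[//] : flip A *m flip (invmx A) = 1%:M.
by have := flipM (invmx A) A; rewrite [_ * A]mulVmx // flip1.
Qed.

Lemma flip_horner A q : flip (horner_mx A q) = horner_mx (flip A) q.
Proof.
rewrite !horner_mx_sum; elim/big_rec2: _ => [|i x y _ <-].
  by apply/matrixP=> i j; rewrite !mxE.
rewrite flipD; congr (_ + _).
have -> k : flip A ^+ k = flip (A ^+ k).
  by elim: k => [|k IHk]; rewrite ?flip1 // exprS IHk exprSr flipM.
by apply/matrixP=> j k; rewrite !mxE.
Qed.

End Companion.

(** * Cyclic vectors *)

Lemma irreducible_factor (F : finFieldType) (p : {poly F}) :
  (1 < size p)%N -> exists2 r, irreducible_poly r & r %| p.
Proof.
(* Coding polynomials as row vectors over a finite field makes [P] boolean; a nonconstant divisor of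
   least size is irreducible. *)
move=> p_gt1; pose P n := [exists u : 'rV[F]_(size p),
  [&& size (rVpoly u) == n, (1 < n)%N & rVpoly u %| p]].
have PI (q : {poly F}) : (1 < size q)%N -> q %| p -> P (size q).
  move=> q_gt1 qp; have p0 : p != 0 by rewrite -size_poly_gt0 ltnW.
  by apply/existsP; exists (poly_rV q); rewrite poly_rV_K ?eqxx ?q_gt1 // dvdp_leq.
have exP : exists n, P n by exists (size p); apply: PI.
case: (ex_minnP exP) => n /existsP[u /and3P[/eqP size_u n_gt1 up]] n_min.
exists (rVpoly u) => //; split=> [|q q_n1 q_dvd]; first by rewrite size_u.
have u0 : rVpoly u != 0 by rewrite -size_poly_gt0 size_u ltnW.
have q0 : q != 0 by apply: contraNneq u0 => q0; rewrite q0 dvd0p in q_dvd.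
rewrite -dvdp_size_eqp // eqn_leq dvdp_leq //= size_u n_min // PI //.
  by rewrite ltn_neqAle eq_sym q_n1 size_poly_gt0.
exact: dvdp_trans up.
Qed.

Section CyclicVector.
Variables (F : finFieldType) (N : nat) (A : 'M[F]_N.+1).
Implicit Types (u v : 'rV[F]_N.+1) (d e p q : {poly F}).

(** [d] generates the annihilator of [v] in the F[X]-module defined by [A]. *)
Definition vorder v d := forall q, (v *m horner_mx A q == 0) = (d %| q).

Lemma mulmx_hornerM v p q :
  v *m horner_mx A (p * q) = v *m horner_mx A p *m horner_mx A q.
Proof. by rewrite rmorphM -mulmxA. Qed.

(** Take a nonzero annihilating polynomial of least size and divide by it; Cayley-Hamilton provides
    one of size [N.+2]. *)
Lemma vorder_exists v : exists2 d, vorder v d & (0 < size d <= N.+2)%N.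
Proof.
pose P (w : 'rV[F]_N.+2) := (w != 0) && (v *m horner_mx A (rVpoly w) == 0).
have Pm : P (poly_rV (char_poly A)).
  rewrite /P poly_rV_K ?size_char_poly // Cayley_Hamilton mulmx0 eqxx andbT.
  apply/eqP=> /(congr1 rVpoly); rewrite poly_rV_K ?size_char_poly // linear0.
  by apply/eqP; rewrite monic_neq0 ?char_poly_monic.
case: (arg_minnP (fun w => size (rVpoly w)) Pm) => w /andP[w0 /eqP vw0] w_min.
have rw0 : rVpoly w != 0.
  by apply: contraNneq w0 => e; rewrite -[w]rVpolyK e linear0.
exists (rVpoly w); last by rewrite size_poly_gt0 rw0 size_poly.
move=> q; rewrite {1}(divp_eq q (rVpoly w)) mulrC rmorphD mulmxDr /=.
rewrite mulmx_hornerM vw0 mul0mx add0r; apply/idP/idP; last first.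
  by move/eqP->; rewrite rmorph0 mulmx0.
move=> vr0; apply: contraT => r0; have lt_r := ltn_modp q (rVpoly w); rewrite rw0 in lt_r.
have le_r : (size (q %% rVpoly w)%R <= N.+2)%N.
  by rewrite (leq_trans (ltnW lt_r)) // size_poly.
have /w_min : P (poly_rV (q %% rVpoly w)).
  rewrite /P poly_rV_K // vr0 andbT; apply: contraNneq r0 => /(congr1 rVpoly).
  by rewrite poly_rV_K // linear0 /dvdp => ->.
by rewrite poly_rV_K // leqNgt lt_r.
Qed.

Lemma vorder_mul v d e : d != 0 -> vorder v (d * e) -> vorder (v *m horner_mx A d) e.
Proof. by move=> d0 vde q; rewrite -mulmx_hornerM vde dvdp_mul2l. Qed.

(** If [q] kills [u + v], then [q * e] kills [u], so [d] divides [q * e] and, by coprimality, [q];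
    likewise for [e]. *)
Lemma vorder_add u v d e :
  vorder u d -> vorder v e -> coprimep d e -> vorder (u + v) (d * e).
Proof.
move=> ud ve cde q; rewrite Gauss_dvdp //; apply/idP/andP=> [/eqP uvq|[]]; last first.
  by rewrite -ud -ve mulmxDl => /eqP-> /eqP->; rewrite addr0.
have uvM p : (u + v) *m horner_mx A (q * p) = 0 by rewrite mulmx_hornerM uvq mul0mx.
split.
  rewrite -(Gauss_dvdpl q cde) -ud; have := uvM e; rewrite mulmxDl.
  have /eqP-> : v *m horner_mx A (q * e) == 0 by rewrite ve dvdp_mull.
  by rewrite addr0 => ->.
rewrite coprimep_sym in cde.
rewrite -(Gauss_dvdpl q cde) -ve; have := uvM d; rewrite mulmxDl.
have /eqP-> : u *m horner_mx A (q * d) == 0 by rewrite ud dvdp_mull.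
by rewrite add0r => ->.
Qed.

Lemma vorder_size v d e : vorder v d -> vorder v e -> size d = size e.
Proof.
by move=> vd ve; apply/eqp_size; rewrite /eqp -vd ve dvdpp -ve vd dvdpp.
Qed.

(* If some vector has order e not dividing the order d of v, then trading the
   power of a suitable prime in d for that in e gives a vector of larger order. *)
Lemma vorder_grow u v d e : d != 0 -> e != 0 -> vorder v d -> vorder u e ->
  ~~ (e %| d) -> exists w f, vorder w f /\ (size d < size f)%N.
Proof.
move=> d0 e0 vd ue ned; pose g := gcdp d e.
have g0 : g != 0 by rewrite gcdp_eq0 (negPf d0).
have [e_g d_g] : e = e %/ g * g /\ d = d %/ g * g by rewrite !divpK ?dvdp_gcdl ?dvdp_gcdr.
set e1 := e %/ g in e_g; set d1 := d %/ g in d_g.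
have e10 : e1 != 0 by apply: contraNneq e0 => z; rewrite e_g z mul0r.
have e1_gt1 : (1 < size e1)%N.
  rewrite ltn_neqAle size_poly_gt0 e10 andbT eq_sym size_poly_eq1.
  apply: contra ned => e1_1; rewrite e_g (eqp_dvdl _ (eqp_mulr g e1_1)) mul1r.
  exact: dvdp_gcdl.
(* Such an [r] divides [e] to a higher power than it divides [d]. *)
have [r irr_r r_e1] := irreducible_factor e1_gt1.
have r0 := irredp_neq0 irr_r.
have c_r_d1 : coprimep r d1.
  apply: coprimep_dvdr r_e1 _; rewrite coprimep_sym.
  by rewrite coprimep_div_gcd // d0.
have r_gt1 : (1 < size r)%N by case: irr_r.
pose P a := r ^+ a %| d.
have P0 : exists a, P a by exists 0%N; rewrite /P expr0 dvd1p.
have Pb a : P a -> (a <= size d)%N.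
  move/(dvdp_leq d0); apply: leq_trans; have := size_exp r a.
  move: r_gt1; set s := size (polyseq (r ^+ a)); set t := size (polyseq r); nia.
case: (ex_maxnP P0 Pb) => a ra_d a_max.
have d_0 : d = r ^+ a * (d %/ r ^+ a) by rewrite mulrC divpK.
set d2 := d %/ r ^+ a in d_0.
have ra0 : r ^+ a != 0 by rewrite expf_neq0.
have nr_d2 : ~~ (r %| d2).
  apply/negP=> r_d2; have /a_max : P a.+1 by rewrite /P exprSr {1}d_0 dvdp_mul2l.
  by rewrite ltnn.
have /dvdpP[f e_f] : r ^+ a.+1 %| e.
  rewrite exprS e_g dvdp_mul //.
  by move: ra_d; rewrite /P [in X in X -> _]d_g Gauss_dvdpr ?coprimep_expl.
have f0 : f != 0 by apply: contraNneq e0 => z; rewrite e_f z mul0r.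
have c : coprimep d2 (r ^+ a.+1).
  by rewrite coprimep_sym coprimep_expl // irreducible_poly_coprime.
rewrite d_0 in vd; rewrite e_f in ue.
(* The summands have the coprime orders [d2] and [r ^+ a.+1], whose product is [d * r]. *)
exists (v *m horner_mx A (r ^+ a) + u *m horner_mx A f), (d2 * r ^+ a.+1); split.
  by apply: vorder_add => //; apply: vorder_mul.
have d20 : d2 != 0 by apply: contraNneq d0 => z; rewrite d_0 z mulr0.
have -> : d2 * r ^+ a.+1 = d * r by rewrite exprSr mulrA [RHS]mulrC [in RHS]d_0; ring.
by rewrite size_mul //; case: (size r) r_gt1 => [|[|s]] // _; rewrite !addnS /= ltnS leq_addr.
Qed.

(** Orders have bounded size, so enlarging them by [vorder_grow] stops at some [d] divisible by all
    orders, and [d] then annihilates [A]. *)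
Lemma minpoly_vector :
  exists v, forall q, v *m horner_mx A q = 0 -> horner_mx A q = 0.
Proof.
pose v0 : 'rV[F]_N.+1 := 0.
have [d vd /andP[d0 _]] := vorder_exists v0; rewrite size_poly_gt0 in d0.
have [n] := ubnP (N.+2 - size d); move: v0 d vd d0.
elim: n => // n IHn v d vd d0 le_n.
have [/forallP all0|] := boolP [forall u : 'rV[F]_N.+1, u *m horner_mx A d == 0].
  exists v => q /eqP; rewrite vd => /dvdpP[x ->].
  have dA0 : horner_mx A d = 0 by apply/row_matrixP=> i; rewrite rowE (eqP (all0 _)) row0.
  by rewrite rmorphM /= dA0 mulr0.
rewrite negb_forall => /existsP[u]; have [e ue /andP[e0 le_e]] := vorder_exists u.
rewrite ue => ned; rewrite size_poly_gt0 in e0.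
have [w [f [wf lt_f]]] := vorder_grow d0 e0 vd ue ned.
have [f' wf' /andP[f'0 le_f]] := vorder_exists w.
rewrite (vorder_size wf' wf) in le_f f'0.
by apply: (IHn w f) => //; rewrite -?size_poly_gt0 //; lia.
Qed.

(** A linear relation between the Krylov rows is a polynomial of degree at most N killing [v], hence
    [A], while the minimal polynomial has degree N + 1. *)
Lemma cyclic_vector : char_poly A = mxminpoly A -> exists v, krylov v A \in unitmx.
Proof.
move=> reg; have [v hv] := minpoly_vector; exists v.
rewrite -row_free_unit; apply/inj_row_free => u.
have -> : u *m krylov v A = v *m horner_mx A (rVpoly u).
  rewrite mulmx_sum_row /rVpoly poly_def rmorph_sum mulmx_sumr.
  apply: eq_bigr => i _; rewrite row_krylov valK /= linearZ /= rmorphXn /=.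
  by rewrite horner_mx_X -scalemxAr.
move/hv/mxminpoly_min; rewrite -reg => /dvdp_leq le_u; apply: contraTeq (leqnn N.+2) => u0.
have ru0 : rVpoly u != 0 by apply: contraNneq u0 => e; rewrite -[u]rVpolyK e linear0.
by have := leq_trans (le_u ru0) (size_poly _ _); rewrite size_char_poly ltnn.
Qed.
End CyclicVector.

(** * Gelfand's trick *)

Lemma row_right_inverse (F : fieldType) m (v : 'rV[F]_m) :
  v != 0 -> exists c : 'cV_m, v *m c = 1%:M.
Proof.
by move=> v0; have /row_freeP[c] : row_free v; [rewrite /row_free rank_rV v0 | exists c].
Qed.

Section GelfandTrick.
Variables (gT : finGroupType) (G H : {group gT}) (d : nat).
Variable rho : mx_representation algC G d.
Variables (theta : gT -> algC) (tau : gT -> gT).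
Hypotheses (sHG : H \subset G) (abs_irr : mx_absolutely_irreducible rho).
Hypothesis thetaM : {in H &, forall x y, theta (x * y)%g = theta x * theta y}.
Hypothesis theta0 : {in H, forall x, theta x != 0}.

Fact eigenproj_key : unit. Proof. by []. Qed.
(** The image under [rho] of the idempotent of the linear character theta; its row space is the
    theta-eigenspace. *)
Definition eigenproj : 'M[algC]_d := locked_with eigenproj_key
  (#|H|%:R^-1 *: \sum_(h in H) (theta h)^-1 *: rho h).
Local Notation P := eigenproj.

Lemma eigenprojE : P = #|H|%:R^-1 *: \sum_(h in H) (theta h)^-1 *: rho h.
Proof. exact: unlock. Qed.

Let cardH0 : #|H|%:R != 0 :> algC.
Proof. by rewrite pnatr_eq0 -lt0n cardG_gt0. Qed.

Lemma mul_eigenproj h : h \in H -> rho h *m P = theta h *: P.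
Proof.
move=> hH; rewrite eigenprojE -scalemxAr scalerA mulrC -scalerA; congr (_ *: _).
rewrite mulmx_sumr scaler_sumr (reindex_inj (mulgI h^-1%g)) /=.
apply: eq_big => [x|x xH]; first by rewrite groupMl ?groupV.
have xH' : x \in H by rewrite groupMl ?groupV in xH.
rewrite -scalemxAr -repr_mxM ?(subsetP sHG) // mulKVg scalerA; congr (_ *: _).
have -> : theta x = theta h * theta (h^-1 * x)%g by rewrite -thetaM ?mulKVg.
by rewrite invfM mulrA divff ?mul1r ?theta0.
Qed.

Lemma eigenproj_mul h : h \in H -> P *m rho h = theta h *: P.
Proof.
move=> hH; rewrite eigenprojE -scalemxAl scalerA mulrC -scalerA; congr (_ *: _).
rewrite mulmx_suml scaler_sumr (reindex_inj (mulIg h^-1%g)) /=.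
apply: eq_big => [x|x xH]; first by rewrite groupMr ?groupV.
have xH' : x \in H by rewrite groupMr ?groupV in xH.
rewrite -scalemxAl -repr_mxM ?(subsetP sHG) // mulgKV scalerA; congr (_ *: _).
have -> : theta x = theta (x * h^-1)%g * theta h by rewrite -thetaM ?mulgKV.
by rewrite invfM mulrCA divff ?mulr1 ?theta0.
Qed.

Lemma mulmx_eigenproj m (v : 'M_(m, d)) :
  {in H, forall h, v *m rho h = theta h *: v} -> v *m P = v.
Proof.
move=> vH; rewrite eigenprojE -scalemxAr mulmx_sumr.
under eq_bigr => h hH do rewrite -scalemxAr vH // scalerA mulVf ?theta0 // scale1r.
by rewrite sumr_const -scaler_nat scalerA mulVf ?scale1r.
Qed.

Lemma eigenproj_idem : P *m P = P.
Proof. by apply: mulmx_eigenproj => h; exact: eigenproj_mul. Qed.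

Hypothesis tauG : {in G, forall x, tau x \in G}.
Hypothesis tauM : {in G &, forall x y, tau (x * y)%g = (tau y * tau x)%g}.
Hypothesis tau_inj : {in H &, injective tau}.
Hypothesis tauH : {in H, forall x, tau x \in H}.
Hypothesis theta_tau : {in H, forall x, theta (tau x) = theta x}.
Hypothesis double_coset : {in G, forall g,
  (exists h h', [/\ h \in H, h' \in H, (h * g = g * h')%g & theta h != theta h']) \/
  (exists h h', [/\ h \in H, h' \in H, tau g = (h * g * h')%g & theta h * theta h' = 1])}.

(** A relation [h g = g h'] with distinct theta values kills the right side, and its image under
    [tau] kills the left side. In the other case the two theta values cancel. *)
Lemma eigenproj_tau g : g \in G -> P *m rho (tau g) *m P = P *m rho g *m P.
Proof.
move=> gG; have [[h [h' [hH h'H hg neq]]]|[h [h' [hH h'H -> th1]]]] := double_coset gG.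
  have vanish x a b : a \in H -> b \in H -> x \in G -> (a * x = x * b)%g ->
      theta a != theta b -> P *m rho x *m P = 0.
    move=> aH bH xG ax ne; have [aG bG] := (subsetP sHG _ aH, subsetP sHG _ bH).
    apply/eqP; have : theta a *: (P *m rho x *m P) = theta b *: (P *m rho x *m P).
      rewrite !scalemxAl -eigenproj_mul // -[P *m _ *m rho x]mulmxA -repr_mxM //.
      rewrite ax repr_mxM // -!mulmxA mul_eigenproj //.
      by rewrite -!scalemxAr -!scalemxAl.
    move/eqP; rewrite -subr_eq0 -scalerBl scaler_eq0 subr_eq0 (negPf ne); exact.
  rewrite (vanish g h h') // (vanish (tau g) (tau h') (tau h)) ?tauH ?tauG //.
    have [hG h'G] := (subsetP sHG _ hH, subsetP sHG _ h'H).
    by rewrite -!tauM // hg.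
  by rewrite !theta_tau // eq_sym.
have [hG h'G] := (subsetP sHG _ hH, subsetP sHG _ h'H).
rewrite !repr_mxM ?groupM // !mulmxA eigenproj_mul // -!mulmxA mul_eigenproj //.
by rewrite -!scalemxAr -scalemxAl scalerA mulrC th1 scale1r !mulmxA.
Qed.

(** Commutativity of the Hecke algebra: [tau] reverses products but leaves every [P *m rho g *m P]
    unchanged. It is applied after expanding the middle [P] over H. *)
Lemma eigenproj_comm a b : a \in G -> b \in G ->
  P *m rho a *m P *m rho b *m P = P *m rho b *m P *m rho a *m P.
Proof.
move=> aG bG; pose S x y := \sum_(h in H) (theta h)^-1 *: (P *m rho (x * h * y)%g *m P).
have SE x y : x \in G -> y \in G -> P *m rho x *m P *m rho y *m P = #|H|%:R^-1 *: S x y.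
  move=> xG yG; rewrite [in X in _ *m X *m _ *m _]eigenprojE -scalemxAr -!scalemxAl; congr (_ *: _).
  rewrite mulmx_sumr !mulmx_suml; apply: eq_bigr => h hH.
  by rewrite -!scalemxAr -!scalemxAl !repr_mxM ?groupM ?(subsetP sHG _ hH) // !mulmxA.
rewrite SE //; transitivity (#|H|%:R^-1 *: S (tau b) (tau a)); last first.
  have split X Y : P *m X *m P *m Y *m P = (P *m X *m P) *m (P *m Y *m P).
    by rewrite !mulmxA -(mulmxA (P *m X) P P) eigenproj_idem.
  by rewrite -SE ?tauG // !split !eigenproj_tau.
congr (_ *: _); rewrite /S.
(* Being injective, [tau] permutes the finite set H, so the default [1] of its chosen inverse is
   never taken there. *)
rewrite [RHS](reindex_onto tau (fun y => odflt 1%g [pick x in H | tau x == y])) /=; last first.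
  move=> y yH; case: pickP => [x /andP[_ /eqP->] //|no].
  have : y \in tau @: H.
    suff -> : tau @: H = H by [].
    apply/eqP; rewrite eqEcard card_in_imset // leqnn andbT.
    by apply/subsetP=> _ /imsetP[x xH ->]; exact: tauH.
  by case/imsetP=> x xH yx; have := no x; rewrite xH yx eqxx.
apply: eq_big => [h|h hH].
  apply/idP/andP=> [hH|[tH /eqP]].
    split; first exact: tauH.
    case: pickP => [x /andP[xH /eqP e]|/(_ h)]; last by rewrite hH eqxx.
    by rewrite /= (tau_inj xH hH e).
  by case: pickP => [x /andP[xH _] /= <- //|_ /= <-]; rewrite group1.
have hG := subsetP sHG h hH.
by rewrite theta_tau // -eigenproj_tau ?groupM // !tauM ?groupM // mulgA.
Qed.

(** By absolute irreducibility the matrices of [rho] span everything, so [eigenproj_comm] extends to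
    arbitrary matrices. *)
Lemma eigenspace_dim1 (v1 v2 : 'rV[algC]_d) : v1 != 0 ->
    {in H, forall h, v1 *m rho h = theta h *: v1} ->
    {in H, forall h, v2 *m rho h = theta h *: v2} ->
  exists a, v2 = a *: v1.
Proof.
move=> v10 /mulmx_eigenproj v1P /mulmx_eigenproj v2P.
have [_ [c_ span]] := mx_abs_irrP abs_irr.
have comm1 X b : b \in G -> P *m X *m P *m rho b *m P = P *m rho b *m P *m X *m P.
  move=> bG; rewrite (span X) !(mulmx_sumr, mulmx_suml); apply: eq_bigr => a aG.
  by rewrite -!(scalemxAl, scalemxAr) eigenproj_comm.
have comm X Y : P *m X *m P *m Y *m P = P *m Y *m P *m X *m P.
  rewrite (span Y) !(mulmx_sumr, mulmx_suml); apply: eq_bigr => b bG.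
  by rewrite -!(scalemxAl, scalemxAr) comm1.
have [c v1c] := row_right_inverse v10.
(* On these rank-one matrices, commutation applied to [v1] reads [v2 = (v2 *m c) *m v1]. *)
have := congr1 (mulmx v1) (comm (c *m v1) (c *m v2)).
rewrite !mulmxA !v1P v1c !mul1mx v1P v1c mul1mx v2P -!mulmxA v1P mulmxA => v2E.
by exists ((v2 *m c) 0 0); rewrite {1}v2E -mul_scalar_mx -mx11_scalar.
Qed.

(** All rows of [P] are multiples of [v], so [P] is [P *m c *m v], with trace
    [v *m P *m c = v *m c = 1]. *)
Lemma mxtrace_eigenproj (v : 'rV[algC]_d) : v != 0 ->
  {in H, forall h, v *m rho h = theta h *: v} -> \tr P = 1.
Proof.
move=> v0 vH; have [c vc] := row_right_inverse v0.
have -> : P = P *m c *m v.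
  apply/row_matrixP=> i; rewrite !row_mul.
  have rowH : {in H, forall h, row i P *m rho h = theta h *: row i P}.
    by move=> h hH; rewrite -row_mul eigenproj_mul // linearZ.
  by have [a ->] := eigenspace_dim1 v0 vH rowH; rewrite -!scalemxAl vc mul1mx.
by rewrite mxtrace_mulC mulmxA (mulmx_eigenproj vH) vc mxtrace1.
Qed.
End GelfandTrick.

(** * Additive characters and duality *)

Section AdditiveCharacter.
Variables (R : finComUnitRingType) (phi : R -> algC).
Hypothesis phi_char : additive_character phi.

Lemma addcharD a b : phi (a + b) = phi a * phi b.
Proof. by case: phi_char. Qed.

Lemma addchar_neq0 a : phi a != 0.
Proof. by case: phi_char. Qed.

Lemma addchar0 : phi 0 = 1.
Proof. by apply: (mulfI (addchar_neq0 0)); rewrite -addcharD addr0 mulr1. Qed.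

Lemma addcharN a : phi (- a) = (phi a)^-1.
Proof. by apply: (mulfI (addchar_neq0 a)); rewrite -addcharD subrr addchar0 divff ?addchar_neq0. Qed.

Variable N : nat.
Local Notation M := 'M[R]_N.+1.

(** Translation by [X0] multiplies the sum by [phi (f X0)]. *)
Lemma sum_char_eq0 (P : pred M) (f : M -> R) (X0 : M) :
    (forall X, P (X + X0) = P X) -> (forall X, f (X + X0) = f X + f X0) ->
    phi (f X0) != 1 -> \sum_(X | P X) phi (f X) = 0.
Proof.
move=> PX0 fX0 ne1; set s := LHS.
have : s = s * phi (f X0).
  rewrite /s {1}(reindex_inj (addIr X0)) mulr_suml.
  by apply: eq_big => // X _; rewrite fX0 addcharD.
move/eqP; rewrite -subr_eq0 -{1}[s]mulr1 -mulrBr mulf_eq0 subr_eq0 [1 == _]eq_sym.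
by rewrite (negPf ne1) orbF => /eqP.
Qed.

Hypothesis phi_nondeg : forall r, r != 0 -> exists c, phi (c * r) != 1.

Lemma mxtrace_delta_mul (c : R) (i j : 'I_N.+1) (Y : M) :
  \tr ((c *: delta_mx j i) *m Y) = c * Y i j.
Proof.
rewrite -scalemxAl mxtraceZ; congr (_ * _).
rewrite -(mul_delta_mx (0 : 'I_1)) -mulmxA mxtrace_mulC.
by rewrite /mxtrace big_ord1 -colE -rowE !mxE.
Qed.

Lemma sum_char_mxtrace (Y : M) :
  \sum_(X : M) phi (\tr (X *m Y)) = if Y == 0 then #|{: M}|%:R else 0.
Proof.
case: eqP => [->|/eqP Y0].
  under eq_bigr => X _ do rewrite mulmx0 mxtrace0 addchar0.
  by rewrite sumr_const.
have [i [j Yij]] : exists i j, Y i j != 0.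
  apply/'exists_existsP; apply: contraNT Y0 => /existsPn h; apply/eqP/matrixP=> i j.
  by have /existsPn/(_ j)/negbNE/eqP-> := h i; rewrite mxE.
have [c hc] := phi_nondeg Yij.
apply: (@sum_char_eq0 predT _ (c *: delta_mx j i)) => // [X|].
  by rewrite mulmxDl mxtraceD.
by rewrite mxtrace_delta_mul.
Qed.

Lemma sum_char_trig (Y : M) :
  \sum_(X : M | is_trig_mx X) phi (\tr (X *m Y)) =
  if strict_trig Y then #|[pred X : M | is_trig_mx X]|%:R else 0.
Proof.
case: (boolP (strict_trig Y)) => [Ys|nYs].
  under eq_bigr => X Xt do rewrite mxtrace_trigM // addchar0.
  by rewrite sumr_const.
have [i [j [ij Yij]]] : exists i j : 'I_N.+1, (i <= j)%N /\ Y i j != 0.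
  move: nYs; rewrite negb_forall => /existsP[i]; rewrite negb_forall => /existsP[j].
  by rewrite negb_imply => /andP[ij Yij]; exists i, j.
have [c hc] := phi_nondeg Yij.
have dt : is_trig_mx (c *: delta_mx j i : M).
  apply/is_trig_mxP=> k l kl; rewrite !mxE; case: eqP => [ek|]; last by rewrite mulr0.
  by case: eqP => [el|]; rewrite ?mulr0 //; move: kl; rewrite ek el ltnNge ij.
apply: (@sum_char_eq0 _ _ (c *: delta_mx j i)) => // [X|X|].
- have tD (A B : M) : is_trig_mx A -> is_trig_mx B -> is_trig_mx (A + B).
    move=> /is_trig_mxP hA /is_trig_mxP hB; apply/is_trig_mxP=> k l kl.
    by rewrite mxE hA ?hB ?addr0.
  have dt' : is_trig_mx (- (c *: delta_mx j i) : M).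
    by apply/is_trig_mxP=> k l /(is_trig_mxP dt); rewrite !mxE => ->; rewrite oppr0.
  apply/idP/idP=> h; last exact: tD.
  by rewrite -[X](addrK (c *: delta_mx j i)) tD.
- by rewrite mulmxDl mxtraceD.
by rewrite mxtrace_delta_mul.
Qed.

Local Notation J := (shift_mx R N).

(* Fourier inversion on matrices: the orthogonal of [u] (strictly triangular) is
   [b] (triangular), so that of [u] cap [g u g^-1] is [b + g b g^-1]. *)
Lemma shift_like_conj (g : M) : g \in unitmx ->
    (forall Y : M, strict_trig Y -> strict_trig (invmx g *m Y *m g) ->
      phi (\tr (J *m (invmx g *m Y *m g))) = phi (\tr (J *m Y))) ->
  exists y1 y2 : M, [/\ is_trig_mx (y1 - J), is_trig_mx (y2 - J) & y1 *m g = g *m y2].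
Proof.
move=> ug compat.
pose Z b1 b2 : M := (J + b1) - g *m (J + b2) *m invmx g.
have [/existsP[b1 /existsP[b2 /and3P[t1 t2 /eqP Z0]]]|no] := boolP [exists b1 : M, exists b2 : M,
    [&& is_trig_mx b1, is_trig_mx b2 & Z b1 b2 == 0]].
  exists (J + b1), (J + b2); rewrite ![_ + _ - J]addrAC subrr !add0r; split=> //.
  by have /eqP := Z0; rewrite subr_eq0 => /eqP->; rewrite mulmxKV.
(* If [Z] never vanishes, summing over [Y] first gives 0; summing over [b1] and [b2] first gives a
   positive number, since [Y = 0] contributes. *)
pose S := \sum_(b1 : M | is_trig_mx b1) \sum_(b2 : M | is_trig_mx b2)
  \sum_(Y : M) phi (\tr (Y *m Z b1 b2)).
have S0 : S = 0.
  rewrite /S big1 // => b1 t1; rewrite big1 // => b2 t2; rewrite sum_char_mxtrace.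
  case: eqP => // Z0; case/negP: no; apply/existsP; exists b1; apply/existsP; exists b2.
  by rewrite t1 t2 Z0 /=.
pose c : algC := #|[pred X : M | is_trig_mx X]|%:R.
suff SE : S = \sum_(Y : M | strict_trig Y && strict_trig (invmx g *m Y *m g)) c ^+ 2.
  move: S0; rewrite SE sumr_const => /eqP; rewrite mulrn_eq0 expf_eq0 /= pnatr_eq0.
  case/orP=> /eqP/card0_eq/(_ 0); rewrite !inE.
    by rewrite unfold_in mulmx0 mul0mx strict_trig0.
  by move/negP; case; apply/is_trig_mxP=> i j _; rewrite mxE.
rewrite /S [RHS]big_mkcond.
under [LHS]eq_bigr => b1 _ do rewrite exchange_big.
rewrite exchange_big; apply: eq_bigr => Y _.
pose Y' := invmx g *m Y *m g.
have trZ b1 b2 : \tr (Y *m Z b1 b2) =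
    (\tr (J *m Y) - \tr (J *m Y')) + (\tr (b1 *m Y) + \tr (b2 *m - Y')).
  have cyc b : \tr (Y *m (g *m b *m invmx g)) = \tr (b *m Y').
    by rewrite mulmxA mxtrace_mulC !mulmxA mxtrace_mulC !mulmxA.
  rewrite /Z mulmxBr linearB /= cyc mulmxDr mulmxDl mulmxN !linearD linearN /=.
  by rewrite [\tr (Y *m J)]mxtrace_mulC [\tr (Y *m b1)]mxtrace_mulC; ring.
under [LHS]eq_bigr => b1 _ do under eq_bigr => b2 _ do rewrite trZ !addcharD.
under [LHS]eq_bigr => b1 _ do rewrite -mulr_sumr -mulr_sumr sum_char_trig.
rewrite -mulr_sumr -mulr_suml sum_char_trig.
have -> : strict_trig (- Y') = strict_trig Y'.
  by apply/idP/idP => /strict_trigN //; rewrite opprK.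
case: (boolP (strict_trig Y)) => Ys; last by rewrite mul0r mulr0.
case: (boolP (strict_trig Y')) => Y's; last by rewrite !mulr0.
by rewrite addcharN compat // divff ?addchar_neq0 // mul1r.
Qed.

End AdditiveCharacter.

(** * The Whittaker character of the unitriangular group *)

Section UnitriGroup.
Variables (R : finComUnitRingType) (N : nat).
Local Notation M := 'M[R]_N.+1.
Local Notation GL := {'GL_N.+1[R]}.
Local Notation J := (shift_mx R N).

(* [s = w ^+ i] gives the intersection of the unitriangular group with the
   i-th congruence subgroup. *)
Definition unitri_set (s : R) : {set GL} :=
  [set g : GL | [exists Y : M, strict_trig Y && (GLval g == 1 + s *: Y)]].

Lemma unitri_setP s (g : GL) :
  reflect (exists2 Y : M, strict_trig Y & GLval g = 1 + s *: Y) (g \in unitri_set s).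
Proof.
rewrite inE; apply: (iffP existsP) => [[Y /andP[Ys /eqP gY]]|[Y Ys gY]]; exists Y => //.
by rewrite Ys gY eqxx.
Qed.

Lemma unitri_group_set s : group_set (unitri_set s).
Proof.
apply/group_setP; split; first by apply/unitri_setP; exists 0; rewrite ?strict_trig0 // scaler0 addr0.
move=> g h /unitri_setP[Y Ys gY] /unitri_setP[Z Zs hZ].
apply/unitri_setP; exists (Y + Z + s *: (Y * Z)).
  by rewrite !(strict_trigD, strict_trigZ, strict_trigM).
rewrite GL_ME gY hZ mulrDl mul1r mulrDr mulr1 !scalerDr -scalerAl -scalerAr.
by rewrite !addrA; congr (_ + _); rewrite -!addrA; congr (_ + _); rewrite addrC.
Qed.

Canonical unitri_group s := Group (unitri_group_set s).

Lemma mem_unitri (g : GL) : (g \in unitri_set 1) = strict_trig (GLval g - 1 : M).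
Proof.
apply/unitri_setP/idP => [[Y Ys ->]|gs]; first by rewrite scale1r addrAC subrr add0r.
by exists (GLval g - 1) => //; rewrite scale1r addrC subrK.
Qed.

Lemma unitri_sub s : unitri_set s \subset unitri_set 1.
Proof.
apply/subsetP=> g /unitri_setP[Y Ys gY]; apply/unitri_setP; exists (s *: Y).
  exact: strict_trigZ.
by rewrite scale1r.
Qed.

Lemma mxtrace_shift : \tr J = 0.
Proof. by rewrite /mxtrace big1 // => i _; rewrite mxE; case: eqP => //; lia. Qed.

Lemma shift_trace_unitri s (Y : M) : \tr (J *m (1 + s *: Y)) = s * \tr (J *m Y).
Proof.
by rewrite mulmxDr mulmx1 linearD /= mxtrace_shift add0r -scalemxAr mxtraceZ.
Qed.

Lemma shift_traceM (g h : GL) : g \in unitri_set 1 -> h \in unitri_set 1 ->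
  \tr (J *m GLval (g * h)%g) = \tr (J *m GLval g) + \tr (J *m GLval h).
Proof.
move=> /unitri_setP[Y Ys gY] /unitri_setP[Z Zs hZ].
rewrite GL_ME gY hZ !scale1r mulrDl mul1r mulrDr mulr1 !mulmxDr !linearD /=.
by rewrite mxtrace_shiftM // addr0 mulmx1 mxtrace_shift !add0r addrC.
Qed.

Lemma shift_traceV (g : GL) : g \in unitri_set 1 ->
  \tr (J *m GLval g^-1%g) = - \tr (J *m GLval g).
Proof.
move=> gU; apply/eqP; rewrite -addr_eq0 -shift_traceM ?groupV // mulVg GL_1E.
by rewrite mulmx1 mxtrace_shift.
Qed.

Definition flipGL (g : GL) : GL := FinRing.Unit (flip_unit (GL_unitmx g) : flip (GLval g) \is a GRing.unit).

Lemma flipGLM (g h : GL) : flipGL (g * h)%g = (flipGL h * flipGL g)%g.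
Proof. by apply: val_inj; exact: flipM. Qed.

Lemma flipGLK : involutive flipGL.
Proof. by move=> g; apply: val_inj; exact: flipK. Qed.

Lemma flipGLV (g : GL) : flipGL g^-1%g = (flipGL g)^-1%g.
Proof.
apply: (mulgI (flipGL g)); rewrite mulgV -flipGLM mulVg.
by apply: val_inj; exact: flip1.
Qed.

Lemma flipGL_unitri (g : GL) : g \in unitri_set 1 -> flipGL g \in unitri_set 1.
Proof.
rewrite !mem_unitri => gs.
have -> : GLval (flipGL g) - 1 = flip (GLval g - 1 : M) by rewrite flipB flip1.
exact: flip_strict_trig.
Qed.

Lemma shift_trace_flip (g : GL) : \tr (J *m GLval (flipGL g)) = \tr (J *m GLval g).
Proof.
have -> : J *m GLval (flipGL g) = flip (GLval g * J) by rewrite flipM flip_shift.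
by rewrite mxtrace_flip [LHS]mxtrace_mulC.
Qed.

(* All shift-like matrices with a given characteristic polynomial are conjugate under the
   unitriangular group to one companion matrix C, so both sides of [y1 g = g y2] can be
   brought to C, making g a polynomial in C; the same applies to [flip C]. *)
Lemma flip_in_double_coset (g : GL) (y1 y2 : M) :
    is_trig_mx (y1 - J) -> is_trig_mx (y2 - J) -> y1 *m GLval g = GLval g *m y2 ->
  exists a b : GL, [/\ a \in unitri_set 1, b \in unitri_set 1, flipGL g = (a * g * b)%g
    & \tr (J *m GLval a) + \tr (J *m GLval b) = 0].
Proof.
move=> t1 t2 yg; pose p := char_poly y1; pose C : M := companion N p.
have conj y : is_trig_mx (y - J) -> char_poly y = p ->
    exists2 u : GL, u \in unitri_set 1 & GLval u *m y = C *m GLval u.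
  move=> ty yp; pose L := krylov (delta_mx 0 0) y.
  have Ls : strict_trig (L - 1) by exact: krylov_unitri.
  exists (FinRing.Unit (unitri_unit Ls : L \is a GRing.unit)); first by rewrite mem_unitri.
  by rewrite /= /C -yp; exact: krylov_companion.
have y2p : char_poly y2 = p.
  by rewrite /p; apply: (char_poly_conj (GL_unitmx g)); exact: esym yg.
have [u1 u1U u1y] := conj y1 t1 erefl.
have [u2 u2U u2y] := conj y2 t2 y2p.
have [u3 u3U u3y] : exists2 u : GL, u \in unitri_set 1 & GLval u *m flip C = C *m GLval u.
  apply: conj; last by rewrite char_poly_flip -/p -y2p -(char_poly_conj (GL_unitmx u2) u2y).
  by rewrite -flip_shift -flipB flip_trig // companion_shift_like.
pose g' := (u1 * g * u2^-1)%g.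
have g'C : C *m GLval g' = GLval g' *m C.
  have u2u : (GLval u2 : M) \in unitmx := GL_unitmx u2.
  have g'E : GLval g' = GLval u1 *m GLval g *m invmx (GLval u2 : M) by [].
  have u2C : invmx (GLval u2 : M) *m C = y2 *m invmx (GLval u2 : M).
    apply: (can_inj (mulKmx u2u)).
    by rewrite mulKVmx // mulmxA u2y mulmxK.
  by rewrite g'E -[RHS]mulmxA u2C !mulmxA -u1y -[GLval u1 *m y1 *m _]mulmxA yg !mulmxA.
have [q g'q] := commute_companion g'C.
have u3g' : (u3 * flipGL g')%g = (g' * u3)%g.
  apply: val_inj; change (GLval u3 *m flip (GLval g' : M) = GLval g' *m GLval u3).
  rewrite g'q flip_horner !horner_mx_sum mulmx_sumr mulmx_suml.
  apply: eq_bigr => i _; rewrite -scalemxAr -scalemxAl; congr (_ *: _).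
  elim: (i : nat) => [|k IHk]; first by rewrite !expr0 mulmx1 mul1mx.
  have XS (X : M) : X ^+ k.+1 = X ^+ k *m X by rewrite exprSr.
  by rewrite !XS mulmxA IHk -mulmxA u3y mulmxA.
have gE : g = (u1^-1 * g' * u2)%g by rewrite /g' !mulgA mulVg mul1g mulgKV.
have tg' : flipGL g' = (u3^-1 * g' * u3)%g by rewrite -mulgA -u3g' mulKg.
(* Solved from [tg'] and [gE]. Each of [u1], [u2], [u3] enters the traces twice with opposite signs,
   the flip preserving them. *)
exists (flipGL u2 * u3^-1 * u1)%g, (u2^-1 * u3 * (flipGL u1)^-1)%g.
have t1U := flipGL_unitri u1U; have t2U := flipGL_unitri u2U.
split; rewrite ?groupM ?groupV //.
  by clearbody g'; rewrite gE !flipGLM flipGLV tg' !mulgA !mulgK.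
rewrite !shift_traceM ?groupM ?groupV // !shift_traceV // !shift_trace_flip; ring.
Qed.

Variable phi : R -> algC.
Hypothesis phi_char : additive_character phi.
Hypothesis phi_nondeg : forall r, r != 0 -> exists c, phi (c * r) != 1.

Definition whittaker_mx (X : M) := phi (\tr (J *m X)).
Definition whittaker (g : GL) := whittaker_mx (GLval g).

Lemma whittakerM : {in unitri_set 1 &, forall g h, whittaker (g * h)%g = whittaker g * whittaker h}.
Proof. by move=> g h gU hU; rewrite /whittaker /whittaker_mx shift_traceM // addcharD. Qed.

Lemma flip_double_coset (g : GL) :
  (exists h h', [/\ h \in unitri_set 1, h' \in unitri_set 1, (h * g = g * h')%g
     & whittaker h != whittaker h']) \/
  (exists h h', [/\ h \in unitri_set 1, h' \in unitri_set 1, flipGL g = (h * g * h')%g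
     & whittaker h * whittaker h' = 1]).
Proof.
have [/existsP[h /existsP[h' /and4P[? ? /eqP ? ?]]]|no] := boolP [exists h : GL, exists h' : GL,
   [&& h \in unitri_set 1, h' \in unitri_set 1, (h * g == g * h')%g & whittaker h != whittaker h']].
  by left; exists h, h'.
have mem1 (Y : M) : strict_trig Y -> strict_trig (1 + Y - 1).
  by rewrite addrAC subrr add0r.
have [Y Ys Y's|y1 [y2 [t1 t2 yg]]] := shift_like_conj phi_char phi_nondeg (GL_unitmx g : (GLval g : M) \in unitmx).
  (* If theta separated [1 + Y] from its conjugate by [g], this pair would be a relation excluded by
     [no]. *)
  pose h : GL := FinRing.Unit (unitri_unit (mem1 _ Ys) : 1 + Y \is a GRing.unit).
  pose h' : GL := FinRing.Unit (unitri_unit (mem1 _ Y's) : 1 + _ \is a GRing.unit).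
  have thE (Z : M) : whittaker_mx (1 + Z) = phi (\tr (J *m Z)).
    by rewrite /whittaker_mx mulmxDr mulmx1 linearD /= mxtrace_shift add0r.
  rewrite -!thE; apply/eqP; apply: contraR no => ne.
  apply/existsP; exists h; apply/existsP; exists h'.
  apply/and4P; split; rewrite ?mem_unitri ?mem1 //; last by rewrite eq_sym; exact: ne.
  apply/eqP/val_inj.
  change ((1 + Y) *m GLval g = GLval g *m (1 + invmx (GLval g : M) *m Y *m GLval g)).
  by rewrite mulmxDl mulmxDr mul1mx mulmx1 !mulmxA mulmxV ?mul1mx // (GL_unitmx g).
have [a [b [aU bU fg ab0]]] := flip_in_double_coset t1 t2 yg.
by right; exists a, b; split=> //; rewrite -addcharD // ab0 addchar0.
Qed.

Section Multiplicity.
Variables (d : nat) (rho : mx_representation algC 'GL_N.+1[R] d).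
Hypothesis abs_irr : mx_absolutely_irreducible rho.

Lemma whittaker_mxtrace (v : 'rV_d) : v != 0 ->
    {in unitri_set 1, forall g, v *m rho g = whittaker g *: v} ->
  \tr (eigenproj (unitri_group 1) rho whittaker) = 1.
Proof.
apply: (@mxtrace_eigenproj _ _ _ _ rho whittaker flipGL (subsetT _) abs_irr) => //.
- exact: whittakerM.
- by move=> x _; exact: addchar_neq0.
- by move=> x _; rewrite inE.
- by move=> x y _ _; exact: flipGLM.
- by move=> x y _ _; exact: (can_inj flipGLK).
- exact: flipGL_unitri.
- by move=> x _; rewrite /whittaker /whittaker_mx shift_trace_flip.
by move=> g _; exact: flip_double_coset.
Qed.
End Multiplicity.
End UnitriGroup.

(** * Whittaker vectors in regular representations *)

Section TruncatedDVR.
Variables (R : finComUnitRingType) (w : R) (ell : nat).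
Hypothesis hR : trunc_dvr w ell.

(** Factors [w] are removed from [r] until a unit remains; this happens before [ell] steps because
    [w ^+ ell = 0]. *)
Lemma trunc_dvr_divides (r : R) : r != 0 -> exists c, c * r = w ^+ ell.-1.
Proof.
case: hR => wl0 wl1 nonunit r0.
suff H n : (n <= ell)%N -> (exists c, c * r = w ^+ ell.-1) \/ exists b, r = w ^+ n * b.
  by case: (H ell (leqnn _)) => // -[b rb]; rewrite rb wl0 mul0r eqxx in r0.
elim: n => [|n IHn] le_n; first by right; exists r; rewrite expr0 mul1r.
case: (IHn (ltnW le_n)) => [|[b rb]]; first by left.
have [ub|/nonunit[b' bE]] := boolP (b \is a GRing.unit); last first.
  by right; exists b'; rewrite rb bE exprSr mulrA.
left; exists (w ^+ (ell.-1 - n) * b^-1).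
rewrite rb -mulrA [b^-1 * _]mulrC -mulrA mulrV // mulr1 -exprD.
by congr (_ ^+ _); lia.
Qed.

Lemma trunc_dvr_nondeg (phi : R -> algC) :
    (exists a : R, phi (w ^+ ell.-1 * a) != 1) ->
  forall r, r != 0 -> exists c, phi (c * r) != 1.
Proof.
move=> [a ha] r /trunc_dvr_divides[c cr]; exists (a * c).
by rewrite -mulrA cr mulrC.
Qed.

Lemma trunc_dvr_ann (a : R) : w ^+ ell.-1 * a = 0 -> exists b, a = w * b.
Proof.
case: hR => _ wl1 nonunit wa; apply: nonunit; apply: contra wl1 => ua.
by rewrite -[_ ^+ _](mulrK ua) wa mul0r.
Qed.

Variables (k : finFieldType) (pi : {rmorphism R -> k}).
Hypothesis hpi : residue_map w pi.

Lemma residue_unit (a : R) : pi a != 0 -> a \is a GRing.unit.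
Proof.
case: hR hpi => _ _ nonunit [_ ker]; apply: contraNT => /nonunit h.
by apply/eqP/ker.
Qed.

Lemma residue_unitmx n (X : 'M[R]_n) : map_mx pi X \in unitmx -> X \in unitmx.
Proof. by rewrite !unitmxE det_map_mx unitfE => /residue_unit. Qed.

Lemma residue_w : pi w = 0.
Proof. by case: hpi => _ ->; exists 1; rewrite mulr1. Qed.

Lemma residue_surj_mx m n (X : 'M[k]_(m, n)) : exists Y : 'M[R]_(m, n), map_mx pi Y = X.
Proof.
have [surj _] := hpi.
have h i : exists f : {ffun 'I_n -> R}, forall j, pi (f j) = X i j.
  have [f hf] := fin_all_exists (fun j => surj (X i j)).
  by exists [ffun j => f j] => j; rewrite ffunE.
have [f hf] := fin_all_exists h.
by exists (\matrix_(i, j) f i j); apply/matrixP=> i j; rewrite !mxE.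
Qed.

(** A cyclic vector of the reduction lifts to R, and its Krylov matrix is invertible because the
    reduction is. *)
Lemma regular_conj_companion N (X : 'M[R]_N.+1) : Defs.regular_mx (map_mx pi X) ->
  exists2 g : 'M[R]_N.+1, g \in unitmx & exists p, g *m X = companion N p *m g.
Proof.
move/eqP/cyclic_vector=> [v uv]; have [v' v'v] := residue_surj_mx v.
exists (krylov v' X); last by exists (char_poly X); exact: krylov_companion.
apply: residue_unitmx; suff -> : map_mx pi (krylov v' X) = krylov v (map_mx pi X) by [].
apply/row_matrixP=> i; rewrite -map_row !row_krylov map_mxM v'v; congr (_ *m _).
exact: rmorphXn.
Qed.

Lemma unit_1wZ N j (c : 'M[R]_N.+1) : (0 < j)%N -> 1 + w ^+ j *: c \in unitmx.
Proof.
move=> j0; apply: residue_unitmx; rewrite map_mxD map_mxZ rmorphXn residue_w expr0n.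
by rewrite (gtn_eqF j0) scale0r addr0 map_mx1 unitmx1.
Qed.

(** * Extending theta down the congruence filtration *)

Section WhittakerVector.
Variables (phi : R -> algC) (N d : nat) (p : {poly R}).
Hypothesis phi_char : additive_character phi.
Hypothesis phi_nondeg : forall r, r != 0 -> exists c, phi (c * r) != 1.
Local Notation M := 'M[R]_N.+1.
Local Notation GL := {'GL_N.+1[R]}.
Local Notation J := (shift_mx R N).
Variable rho : mx_representation algC 'GL_N.+1[R] d.
Local Notation C := (companion N p).
Local Notation theta := (@whittaker R N phi).

Definition congruence_type (v : 'rV[algC]_d) := forall (g : GL) (y : M),
  GLval g = 1 + w ^+ ell.-1 *: y -> v *m rho g = phi (w ^+ ell.-1 * \tr (C *m y)) *: v.

Definition theta_eigen i (v : 'rV[algC]_d) :=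
  {in unitri_set N (w ^+ i), forall g, v *m rho g = theta g *: v}.

Lemma congruence_commute (g x : GL) (z y : M) j : (0 < j)%N ->
  GLval g = 1 + w ^+ ell.-1 *: z -> GLval x = 1 + w ^+ j *: y -> (g * x = x * g)%g.
Proof.
move=> j0 gE xE; apply: val_inj.
change (GLval g * GLval x = GLval x * GLval g :> M).
have w0 : w ^+ ell.-1 * w ^+ j = 0.
  case: hR => wl0 _ _; rewrite -exprD.
  have -> : (ell.-1 + j = ell + (ell.-1 + j - ell))%N by lia.
  by rewrite exprD wl0 mul0r.
rewrite gE xE; change ((1 + w ^+ ell.-1 *: z) *m (1 + w ^+ j *: y) =
  (1 + w ^+ j *: y) *m (1 + w ^+ ell.-1 *: z)).
rewrite !mulmxDl !mulmxDr !mul1mx !mulmx1 -!scalemxAl -!scalemxAr !scalerA.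
by rewrite [w ^+ j * _]mulrC w0 !scale0r !addr0 addrAC.
Qed.

Lemma repr_GLM (g h : GL) : rho (g * h)%g = rho g *m rho h.
Proof. by rewrite repr_mxM ?inE. Qed.

(** Start of the descent: C and J differ by a lower triangular matrix, which is trace-orthogonal to
    [Y]. *)
Lemma congruence_type_eigen v : congruence_type v -> theta_eigen ell.-1 v.
Proof.
move=> vC g /unitri_setP[Y Ys gY]; rewrite (vC g Y gY); congr (_ *: _).
rewrite /whittaker /whittaker_mx gY shift_trace_unitri.
by rewrite (mxtrace_shift_like (companion_shift_like _ _) Ys).
Qed.

(* Averaging [rho k * P * rho k^-1] over [k = 1 + w^j c] kills every [u] of the
   unitriangular congruence subgroup of level i not commuting with C modulo w; since only
   0 among strictly triangular matrices commutes with C, just level [i.+1] survives. *)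
Lemma theta_eigen_descent i j v : (0 < j)%N -> (i + j = ell.-1)%N ->
    v != 0 -> congruence_type v -> theta_eigen i.+1 v ->
  exists2 v', v' != 0 & theta_eigen i v' /\ ((0 < i)%N -> congruence_type v').
Proof.
move=> j0 ij v0 vC vth.
pose H := unitri_group N (w ^+ i); pose P := eigenproj H rho theta.
pose kap (c : M) : GL := FinRing.Unit (unit_1wZ c j0 : 1 + w ^+ j *: c \is a GRing.unit).
have subH : H \subset unitri_set N 1 := unitri_sub _ _.
have thM : {in H &, forall x y, theta (x * y)%g = theta x * theta y}.
  by move=> x y /(subsetP subH) xU /(subsetP subH) yU; exact: whittakerM.
have th0 : {in H, forall x, theta x != 0} by move=> x _; exact: addchar_neq0.
have thE (Y : M) (g : GL) s : GLval g = 1 + s *: Y -> theta g = phi (s * \tr (J *m Y)).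
  by move=> gY; rewrite /whittaker /whittaker_mx gY shift_trace_unitri.
(* Such a vector is a theta-eigenvector by projection. It keeps the congruence type for [0 < i],
   since K^(l-1) then commutes with [kap c] and with [H]. *)
suff [c vc0] : exists c, v *m rho (kap c) *m P != 0.
  exists (v *m rho (kap c) *m P) => //; split=> [h hH|i0 g y gE].
    by rewrite -mulmxA eigenproj_mul ?subsetT // scalemxAr.
  have comm_h h : h \in H -> rho h *m rho g = rho g *m rho h.
    case/unitri_setP=> Y _ hE; rewrite -!repr_GLM.
    by rewrite (congruence_commute i0 gE hE).
  have -> : v *m rho (kap c) *m P *m rho g = v *m rho g *m rho (kap c) *m P.
    rewrite -mulmxA -[v *m rho g *m _]mulmxA -repr_GLM (congruence_commute j0 gE (erefl _ : GLval (kap c) = _)).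
    rewrite repr_GLM !mulmxA -!mulmxA; congr (_ *m (_ *m _)).
    rewrite /P eigenprojE -scalemxAl -scalemxAr mulmx_suml mulmx_sumr; congr (_ *: _).
    by apply: eq_bigr => h hH; rewrite -scalemxAl -scalemxAr comm_h.
  by rewrite (vC g y gE) -!scalemxAl.
pose S := \sum_(c : M) v *m rho (kap c) *m P *m rho (kap c)^-1%g.
suff S0 : S != 0.
  apply/existsP; apply: contraNT S0 => /existsPn no; rewrite /S big1 // => c _.
  by have := no c; rewrite negbK => /eqP->; rewrite mul0mx.
(* The contribution of [h] to [S], up to scalars; orthogonality in [c] decides whether it
   vanishes. *)
pose T (h : GL) := \sum_(c : M) v *m rho (kap c * h * (kap c)^-1)%g.
have term h : h \in H -> T h = 0 \/ T h = (#|{: M}|%:R * theta h) *: v.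
  case/unitri_setP=> Y Ys hY; have uh : (GLval h : M) \in unitmx := GL_unitmx h.
  pose D := Y *m invmx (GLval h : M) *m C - invmx (GLval h : M) *m C *m Y.
  have TE : T h = (if w ^+ ell.-1 *: D == 0 then #|{: M}|%:R else 0) *: (v *m rho h).
    rewrite -(sum_char_mxtrace phi_char phi_nondeg) scaler_suml; apply: eq_bigr => c _.
    pose z := (c *m Y - Y *m c) *m invmx (GLval h : M).
    have l0 : (0 < ell.-1)%N by rewrite -ij addn_gt0 j0 orbT.
    pose g0 : GL := FinRing.Unit (unit_1wZ z l0 : 1 + w ^+ ell.-1 *: z \is a GRing.unit).
    (* Since [i + j = ell.-1], the commutator of [kap c] and [h] lies in K^(l-1), and [z] is linear
       in [c]. *)
    have -> : (kap c * h * (kap c)^-1)%g = (g0 * h)%g.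
      apply: (mulIg (kap c)); rewrite mulgKV; apply: val_inj.
      change ((1 + w ^+ j *: c) *m GLval h =
              (1 + w ^+ ell.-1 *: z) *m GLval h *m (1 + w ^+ j *: c)).
      have w0 : w ^+ ell.-1 * w ^+ j = 0.
        case: hR => wl0 _ _; rewrite -exprD.
        have -> : (ell.-1 + j = ell + (j - 1))%N by lia.
        by rewrite exprD wl0 mul0r.
      have zh : (w ^+ ell.-1 *: z) *m GLval h = w ^+ ell.-1 *: (c *m Y - Y *m c).
        by rewrite -scalemxAl /z mulmxKV.
      rewrite [(1 + w ^+ ell.-1 *: z) *m _]mulmxDl zh mulmxDl mul1mx.
      rewrite [(w ^+ ell.-1 *: _) *m _]mulmxDr mulmx1 -scalemxAr -scalemxAl !scalerA.
      rewrite [w ^+ j * _]mulrC w0 scale0r addr0 hY !(mulmxDl, mulmxDr) !mul1mx !mulmx1.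
      rewrite -!scalemxAl -!scalemxAr !scalerA -!exprD ij [(j + i)%N]addnC ij scalerBr.
      by rewrite -!addrA [_ *: (Y *m c) + _]addrC subrK; congr (_ + _); rewrite addrCA.
    rewrite repr_GLM mulmxA (vC g0 z erefl) -scalemxAl; congr (phi _ *: _).
    rewrite -scalemxAr mxtraceZ; congr (_ * _).
    rewrite /z /D mulmxBr mulmxBl mulmxBr !linearB /=; congr (_ - _).
      by rewrite mxtrace_mulC !mulmxA.
    by rewrite !mulmxA mxtrace_mulC !mulmxA mxtrace_mulC !mulmxA.
  rewrite TE; case: eqP => [D0|_]; last by left; rewrite scale0r.
  right; rewrite -scalerA; congr (_ *: _).
  have uY : GLval h *m Y = Y *m GLval h by rewrite hY mulmxDl mulmxDr mul1mx mulmx1 -scalemxAl -scalemxAr.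
  (* [h D = Y C - C Y], so [Y] commutes with C after scaling by [w ^+ ell.-1]; its first row is zero
     by strictness. *)
  have Y0 : w ^+ ell.-1 *: Y = 0.
    apply: (@commute_companion_eq0 _ _ p).
      apply/eqP; rewrite eq_sym -subr_eq0 -scalerBr.
      have -> : Y *m C - C *m Y = GLval h *m D.
        by rewrite /D mulmxBr !mulmxA uY -[Y *m _ *m _]mulmxA mulmxV // mulmx1 mul1mx.
      by rewrite scalemxAr D0 mulmx0.
    apply/rowP=> l; rewrite !mxE; move/strict_trigP: Ys => ->; rewrite ?mulr0 //.
  (* Division by [w] entry by entry, with quotient 0 on and above the diagonal; this puts [h] at
     level [i.+1], where [vth] applies. *)
  have [Y' YE Y's] : exists2 Y' : M, Y = w *: Y' & strict_trig Y'.
    have h1 a b : exists r, Y a b = w * r /\ ((a <= b)%N -> r = 0).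
      have [ab|ba] := leqP a b.
        by exists 0; move/strict_trigP: Ys => ->; rewrite ?mulr0.
      have /trunc_dvr_ann[r Yr] : w ^+ ell.-1 * Y a b = 0.
        by move/matrixP/(_ a b): Y0; rewrite !mxE.
      by exists r; rewrite Yr; split=> //; rewrite leqNgt ba.
    have h2 a : exists f : {ffun 'I_N.+1 -> R}, forall b, Y a b = w * f b /\ ((a <= b)%N -> f b = 0).
      have [f hf] := fin_all_exists (h1 a).
      by exists [ffun b => f b] => b; rewrite ffunE.
    have [f hf] := fin_all_exists h2.
    exists (\matrix_(a, b) f a b); first by apply/matrixP=> a b; rewrite !mxE; case: (hf a b).
    by apply/strict_trigP=> a b ab; rewrite mxE; case: (hf a b) => _ ->.
  by apply: vth; apply/unitri_setP; exists Y' => //; rewrite hY YE scalerA exprSr.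
have T1 : T 1%g = #|{: M}|%:R *: v.
  rewrite /T; under eq_bigr => c _ do rewrite mulg1 mulgV repr_mx1 mulmx1.
  by rewrite sumr_const scaler_nat.
have M0 : #|{: M}|%:R != 0 :> algC.
  by rewrite pnatr_eq0; apply/eqP=> /card0_eq/(_ 0); rewrite inE.
have SE : S = #|H|%:R^-1 *: \sum_(h in H) (theta h)^-1 *: T h.
  have -> : \sum_(h in H) (theta h)^-1 *: T h =
      \sum_(c : M) \sum_(h in H) (theta h)^-1 *: (v *m rho (kap c * h * (kap c)^-1)%g).
    by rewrite exchange_big; apply: eq_bigr => h _; rewrite scaler_sumr.
  rewrite /S scaler_sumr; apply: eq_bigr => c _.
  rewrite /P eigenprojE -scalemxAr -scalemxAl; congr (_ *: _).
  rewrite mulmx_sumr mulmx_suml; apply: eq_bigr => h _.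
  by rewrite -scalemxAr -scalemxAl !repr_GLM !mulmxA.
(* Every surviving [h] contributes the same positive multiple of [v], and [h = 1] survives. *)
have sumE : \sum_(h in H) (theta h)^-1 *: T h = #|[pred h in H | T h != 0]|%:R *: (#|{: M}|%:R *: v).
  rewrite scaler_nat -sumr_const big_mkcondr; apply: eq_bigr => h hH.
  case: eqP => [->|Th0]; first by rewrite scaler0.
  by case: (term h hH) => // ->; rewrite scalerA mulrCA mulVf ?mulr1 ?th0.
rewrite SE sumE !scaler_eq0 !negb_or v0 M0 andbT invr_neq0 ?pnatr_eq0 -?lt0n ?cardG_gt0 //=.
rewrite andbT; apply/card_gt0P; exists 1%g.
by rewrite inE /= group1 T1 scaler_eq0 negb_or M0 v0.
Qed.

End WhittakerVector.
End TruncatedDVR.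

(** * Multiplicities *)

(* By Clifford, the restriction to H is e times a sum of characters, so that e divides the
   multiplicity of any character of a subgroup of H. *)
Lemma cfRes_mult_free (gT : finGroupType) (G H U : {group gT}) (chi : 'CF(G)) (lambda : 'CF(U)) :
    chi \in irr G -> (H <| G)%g -> U \subset H -> lambda \is a character ->
    '['Res[U] chi, lambda] = 1 ->
  forall j : Iirr H, '['Res[H] chi, 'chi_j] <= 1.
Proof.
case/irrP=> i -> nHG sUH lam_char one j.
have [jH|] := boolP (j \in irr_constt ('Res[H] 'chi_i)); last first.
  by rewrite irr_consttE negbK => /eqP->.
have resE := Clifford_Res_sum_cfclass nHG jH; set e := '[_, _] in resE *.
have /natrP[a eE] : e \is a Num.nat by rewrite Cnat_cfdot_char ?cfRes_char ?irr_char.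
have := one; rewrite -(cfResRes _ sUH (normal_sub nHG)) resE linearZ cfdotZl /= eE.
set m := '[_, lambda]; have /natrP[b ->] : m \is a Num.nat.
  rewrite Cnat_cfdot_char ?cfRes_char // reindex_cfclass // rpred_sum // => l _.
  exact: irr_char.
by rewrite -natrM => /eqP; rewrite pnatr_eq1 muln_eq1 => /andP[/eqP-> _].
Qed.

(** As theta of an inverse is the inverse of theta, the trace of the projector is the inner product
    with the character of theta. *)
Lemma cfdot_Res_linear (gT : finGroupType) (G U : {group gT}) d
    (rho : mx_representation algC G d) (theta : gT -> algC) :
    U \subset G -> {in U &, forall x y, theta (x * y)%g = theta x * theta y} ->
    {in U, forall x, theta x != 0} -> \tr (eigenproj U rho theta) = 1 ->
  exists2 lambda : 'CF(U), lambda \is a character & '['Res[U] (cfRepr rho), lambda] = 1.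
Proof.
move=> sUG thM th0 trP.
have th1 : theta 1%g = 1.
  by apply: (mulfI (th0 _ (group1 U))); rewrite -thM ?group1 // mulg1 mulr1.
have th_repr : mx_repr U (fun x => (theta x)%:M : 'M_1).
  by split=> [|x y xU yU]; rewrite ?th1 // thM // scalar_mxM.
pose lam := cfRepr (MxRepresentation th_repr).
have lamE x : x \in U -> lam x = theta x by move=> xU; rewrite cfunE xU mulr1n mxtrace_scalar.
exists lam; first exact: cfRepr_char.
rewrite -{}trP cfdotE eigenprojE mxtraceZ raddf_sum; congr (_ * _).
apply: eq_bigr => x xU; rewrite -char_inv ?cfRepr_char // lamE ?groupV //.
rewrite cfResE // cfunE (subsetP sUG) // mulr1n /= mxtraceZ mulrC; congr (_ * _).
by apply: (mulfI (th0 _ xU)); rewrite -thM ?groupV // mulgV th1 divff ?th0.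
Qed.

(** * From regularity to a Whittaker vector *)

Section Main.
Variables (R : finComUnitRingType) (w : R) (ell : nat).
Hypothesis hR : trunc_dvr w ell.
Variables (k : finFieldType) (pi : {rmorphism R -> k}).
Hypothesis hpi : residue_map w pi.
Variable phi : R -> algC.
Hypothesis phi_char : additive_character phi.
Hypothesis phi_nondeg : forall r, r != 0 -> exists c, phi (c * r) != 1.
Variables (N d : nat) (rho : mx_representation algC 'GL_N.+1[R] d).

(** Translating the eigenvector by [rho g0^-1] conjugates [X] into its companion form. *)
Lemma regular_congruence_type : regular_rep w ell pi phi rho ->
  exists p, exists2 v, v != 0 & congruence_type w ell phi p rho v.
Proof.
case=> X /(regular_conj_companion hR hpi)[g ug [p gX]] [v v0 vX]; exists p.
pose g0 : {'GL_N.+1[R]} := FinRing.Unit (ug : g \is a GRing.unit).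
exists (v *m rho g0^-1%g).
  apply: contraNneq v0 => /(congr1 (mulmx^~ (rho g0))) /=.
  by rewrite -mulmxA -repr_GLM mulVg repr_mx1 mulmx1 mul0mx => ->.
move=> h y hE; rewrite -mulmxA -repr_GLM.
have -> : (g0^-1 * h = (h ^ g0) * g0^-1)%g by rewrite conjgE !mulgA mulgK.
rewrite repr_GLM mulmxA (vX _ (invmx g *m y *m g)); last first.
  change (invmx g *m (GLval h *m g) = 1 + w ^+ ell.-1 *: (invmx g *m y *m g)).
  by rewrite hE mulmxDl mulmxDr mul1mx mulVmx // -scalemxAl -scalemxAr mulmxA.
rewrite -scalemxAl; congr (phi (_ * _) *: _).
have -> : companion N p = g *m X *m invmx g by rewrite gX mulmxK.
by rewrite -!mulmxA [RHS]mxtrace_mulC !mulmxA.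
Qed.

Lemma regular_whittaker_vector : regular_rep w ell pi phi rho ->
  exists2 v : 'rV[algC]_d, v != 0 & {in unitri_set N (1 : R), forall g : {'GL_N.+1[R]}, v *m rho g = @whittaker R N phi g *: v}.
Proof.
case/regular_congruence_type=> p [v0 v0_neq0 v0C].
(* [n] counts descent steps from level [ell.-1]. Level 0 is the whole unitriangular group; the
   congruence type may be lost there, but no step follows. *)
suff H n i : (i + n = ell.-1)%N -> exists2 v, v != 0 &
    theta_eigen w phi rho i v /\ ((0 < i)%N -> congruence_type w ell phi p rho v).
  by have [v v_neq0 [vth _]] := H ell.-1 0%N erefl; exists v.
elim: n i => [|n IHn] i.
  by rewrite addn0 => ->; exists v0 => //; split=> //; exact: (congruence_type_eigen v0C).
move=> in_l; have [|v v_neq0 [vth vC]] := IHn i.+1; first by rewrite addSnnS in_l.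
exact: (theta_eigen_descent hR hpi phi_char phi_nondeg _ in_l v_neq0 (vC _) vth).
Qed.

End Main.

Lemma SL_normal n (R : finComUnitRingType) : (SL_group n R <| 'GL_n[R])%g.
Proof.
rewrite /normal subsetT /=; apply/subsetP=> x _; rewrite inE; apply/subsetP=> _ /imsetP[y yS ->].
move: yS; rewrite !inE conjgE !GL_MxE !det_mulmx mulrCA => /eqP->.
by rewrite mul1r -det_mulmx -GL_MxE mulVg det1.
Qed.

Unset Implicit Arguments.

Theorem theorem1p4
  (R : finComUnitRingType) (w : R) (ell : nat) (hell : (2 <= ell)%N)
  (hR : trunc_dvr w ell)
  (k : finFieldType) (pi : {rmorphism R -> k}) (hpi : residue_map w pi)
  (phi : R -> algC) (hphi : additive_character phi)
  (hphi_nt : exists a : R, phi (w ^+ ell.-1 * a) != 1)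
  (n : nat) (hn : (0 < n)%N)
  (d : nat) (rho : mx_representation algC 'GL_n[R] d)
  (hirr : mx_irreducible rho)
  (hreg : regular_rep w ell pi phi rho) :
  forall j : Iirr (SL_group n R),
    '['Res[SL_group n R] (cfRepr rho), 'chi_j] <= 1.
Proof.
case: n hn rho hirr hreg => // N _ rho hirr hreg.
have phi_nondeg := trunc_dvr_nondeg hR hphi_nt.
have [v v0 vth] := regular_whittaker_vector hR hpi hphi phi_nondeg hreg.
(* Over the algebraically closed field [algC], irreducibility is absolute. *)
have trP := whittaker_mxtrace hphi phi_nondeg (groupC hirr) v0 vth.
have [|x _|lam lam_char one] := cfdot_Res_linear (subsetT _) _ _ trP.
- exact: whittakerM.
- exact: addchar_neq0.
apply: cfRes_mult_free (SL_normal _ _) _ lam_char one.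
  by apply/irr_reprP; exists (Representation rho).
apply/subsetP=> g; rewrite mem_unitri inE => /unitri_det gs.
exact/eqP.
Qed.
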